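(* Let $\{F_t\}_{t\ge0}\subset\mathrm{Hol}(\Pi)$ be a semigroup generated by $f\in\mathrm{Hol}(\Pi,\mathbb{C})$. Suppose that there exist continuous functions $\gamma_1,\gamma_2:\mathbb{R}^+\to(0,\frac{\pi}{2})$ such that $$-\gamma_1(\mathrm{Re}\,z)\le\arg f(z)\le\gamma_2(\mathrm{Re}\,z)\quad\text{for all } z\in\Pi.$$ Then, for each initial point $z\in\Pi$, the trajectory $\{F_t(z):t\ge0\}$ lies in the domain $$\{u+iv:\ u\ge\mathrm{Re}\,z,\ B_1(u)\le v\le B_2(u)\},$$ where $$B_1(u)=\mathrm{Im}\,z-\int_{\mathrm{Re}\,z}^{u}\tan\gamma_1(s)\,ds,\qquad B_2(u)=\mathrm{Im}\,z+\int_{\mathrm{Re}\,z}^{u}\tan\gamma_2(s)\,ds.$$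
   Context: $\Pi=\{z\in\mathbb{C}:\mathrm{Re}\,z>0\}$, $\mathbb{R}^+=[0,\infty)$. $\mathrm{Hol}(D,U)$ is the set of holomorphic functions on $D$ with values in $U$, and $\mathrm{Hol}(D):=\mathrm{Hol}(D,D)$. A (one-parameter continuous) semigroup on $\Pi$ is a family $\{F_t\}_{t\ge0}\subset\mathrm{Hol}(\Pi)$ with $F_t\circ F_s=F_{t+s}$ for all $t,s\ge0$ and $\lim_{t\to0^+}F_t(z)=z$ for all $z\in\Pi$. Its generator is $f(z)=\lim_{t\to0^+}\frac{F_t(z)-z}{t}$. *)

(* Defs.v *)
From Stdlib Require Export Reals.
From Stdlib Require Import Lra Psatz.
From Coquelicot Require Export Coquelicot.
Open Scope R_scope.

Definition right_half_plane (z : C) : Prop := 0 < Re z.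

Definition whole_plane (z : C) : Prop := True.

(* Complex differentiability at every point of [D], values in [U]. [D] is
   meant to be open, so values of [g] outside [D] are irrelevant. *)
Definition Hol (D U : C -> Prop) (g : C -> C) : Prop :=
  forall z : C, D z ->
    @ex_derive C_AbsRing C_NormedModule g z /\ U (g z).

(* Principal argument, in (-PI, PI], with the convention [Arg 0 = 0];
   see [Arg_bounds] and [Arg_polar]. *)
Definition Arg (w : C) : R :=
  if Ceq_dec w 0 then 0
  else if Rlt_dec (Im w) 0 then - acos (Re w / Cmod w)
  else acos (Re w / Cmod w).

(* The values [F t] matter only for [0 <= t], on the right half-plane. *)
Definition is_semigroup (F : R -> C -> C) : Prop :=
  (forall t : R, 0 <= t -> Hol right_half_plane right_half_plane (F t)) /\
  (forall t s : R, 0 <= t -> 0 <= s ->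
     forall z : C, right_half_plane z -> F t (F s z) = F (t + s) z) /\
  (forall z : C, right_half_plane z ->
     filterlim (fun t : R => F t z) (at_right 0) (locally z)).

Definition is_generator (F : R -> C -> C) (f : C -> C) : Prop :=
  forall z : C, right_half_plane z ->
    filterlim (fun t : R => Cdiv (Cminus (F t z) z) (RtoC t))
      (at_right 0) (locally (f z)).

Lemma Arg_cos_bound (w : C) : w <> 0 -> -1 <= Re w / Cmod w <= 1.
Proof.
  intros Hw.
  assert (Hp : 0 < Cmod w) by now apply Cmod_gt_0.
  assert (H := re_le_Cmod w).
  apply Rabs_le_between in H.
  split.
  - apply Rmult_le_reg_r with (Cmod w); [easy|].
    replace (Re w / Cmod w * Cmod w) with (Re w) by (field; lra). lra.
  - apply Rmult_le_reg_r with (Cmod w); [easy|].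
    replace (Re w / Cmod w * Cmod w) with (Re w) by (field; lra). lra.
Qed.

Lemma Arg_polar (w : C) :
  w = (Cmod w * cos (Arg w), Cmod w * sin (Arg w)).
Proof.
  unfold Arg. destruct (Ceq_dec w 0) as [->|Hw].
  { rewrite Cmod_0. unfold RtoC. f_equal; ring. }
  assert (Hp : 0 < Cmod w) by now apply Cmod_gt_0.
  assert (Hb := Arg_cos_bound w Hw).
  assert (Hs : Cmod w * sin (acos (Re w / Cmod w)) = Rabs (Im w)).
  { rewrite sin_acos by easy.
    rewrite <- (sqrt_Rsqr (Cmod w)) at 1 by lra.
    rewrite <- sqrt_mult.
    - rewrite <- sqrt_Rsqr_abs. f_equal.
      assert (H := Cmod2_alt w).
      unfold Rsqr, Rdiv.
      replace (Cmod w * Cmod w * (1 - Re w * / Cmod w * (Re w * / Cmod w)))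
        with (Cmod w ^ 2 - Re w ^ 2) by (field; lra).
      rewrite H. ring.
    - apply Rle_0_sqr.
    - unfold Rsqr. nra. }
  assert (Hc : Cmod w * (Re w / Cmod w) = Re w) by (field; lra).
  rewrite (surjective_pairing w) at 1.
  destruct (Rlt_dec (Im w) 0) as [Hi|Hi].
  - rewrite cos_neg, sin_neg, cos_acos by easy. f_equal.
    + now symmetry.
    + rewrite Rabs_left in Hs by easy. unfold Im in *. lra.
  - rewrite cos_acos by easy. f_equal.
    + now symmetry.
    + rewrite Rabs_right in Hs by lra. unfold Im in *. lra.
Qed.

Lemma Arg_bounds (w : C) : - PI < Arg w <= PI.
Proof.
  assert (HPI := PI_RGT_0).
  assert (Hpol := Arg_polar w). revert Hpol.
  unfold Arg. destruct (Ceq_dec w 0) as [->|Hw]; [lra|].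
  assert (Hb := acos_bound (Re w / Cmod w)).
  destruct (Rlt_dec (Im w) 0) as [Hi|Hi]; [|lra].
  intros Hpol. split; [|lra].
  destruct (Req_dec (acos (Re w / Cmod w)) PI) as [E|E]; [|lra].
  rewrite E in Hpol. apply (f_equal Im) in Hpol. simpl in Hpol.
  rewrite sin_neg, sin_PI in Hpol. lra.
Qed.

(* Main.v *)
Require Import Defs.
From Stdlib Require Import Reals Lra Lia.
From Stdlib Require Import ClassicalEpsilon.
From Coquelicot Require Import Coquelicot.
Open Scope R_scope.

(** Along a trajectory [w(t) = x(t) + i y(t)] of the semigroup the velocity is
    [f(w)], and the hypothesis on [Arg (f w)] says that this vector lies in the
    closed sector of the right half-plane between the slopes [- tan gamma1 x]
    and [tan gamma2 x] ([sector_of_Arg]).  So [x] has nonnegative velocity, and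
    so have [y + \int tan gamma1] and [\int tan gamma2 - y], where the integrals
    run from [x(0)] to [x(t)]; these three functions are therefore
    nondecreasing in time, and this is the claim.

    The point that needs care is that a semigroup only provides velocities from
    the right ([trajectory_right_derivative]), and a function whose right
    derivative is nonnegative is monotone only if it cannot jump down when
    approached from the left ([nondecreasing_of_right_derivative]).  Left
    continuity of the trajectory is usually obtained from the Schwarz-Pick
    lemma.  Here it comes from the mere continuity of each map [F s]: as
    [F (s + t) z = F s (F t z)], the trajectory is continuous at [s + t] as soon
    as it is continuous at [t > 0], so one continuity point in each interval [(0, T)] suffices; and a right
    continuous function always has one, by a nested interval argument
    ([right_continuous_continuity_point]). *)

(** * Limits and derivatives from the right *)

Definition right_derivative (g : R -> R) (t l : R) : Prop :=
  filterlim (fun h => (g (t + h) - g t) / h) (at_right 0) (locally l).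

Definition right_continuous {U : UniformSpace} (g : R -> U) (t : R) : Prop :=
  filterlim (fun h => g (t + h)) (at_right 0) (locally (g t)).

Lemma at_right_0_iff (P : R -> Prop) :
  at_right 0 P <-> exists d, 0 < d /\ forall h, 0 < h < d -> P h.
Proof.
  split.
  - intros [d Hd]. exists d. split; [apply cond_pos|].
    intros h Hh. apply Hd; [|lra].
    change (Rabs (h - 0) < d). rewrite Rabs_pos_eq; lra.
  - intros [d [Hd H]]. exists (mkposreal d Hd). intros h Hb Hh.
    change (Rabs (h - 0) < d) in Hb. rewrite Rabs_pos_eq in Hb by lra.
    apply H. lra.
Qed.

Lemma at_right_0_pos : at_right 0 (fun h => 0 < h).
Proof. apply at_right_0_iff. exists 1. split; [lra|]. intros h Hh. lra. Qed.

Lemma filterlim_at_right_0_id : filterlim (fun h : R => h) (at_right 0) (locally 0).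
Proof. intros P [d Hd]. exists d. intros h Hb _. now apply Hd. Qed.

Lemma filterlim_Rplus {F : (R -> Prop) -> Prop} {FF : Filter F}
    (a b : R -> R) (la lb : R) :
  filterlim a F (locally la) -> filterlim b F (locally lb) ->
  filterlim (fun h => a h + b h) F (locally (la + lb)).
Proof.
  intros Ha Hb.
  exact (filterlim_comp_2 _ _ _ Ha Hb
           (@filterlim_plus R_AbsRing R_NormedModule la lb)).
Qed.

Lemma filterlim_Rmult {F : (R -> Prop) -> Prop} {FF : Filter F}
    (a b : R -> R) (la lb : R) :
  filterlim a F (locally la) -> filterlim b F (locally lb) ->
  filterlim (fun h => a h * b h) F (locally (la * lb)).
Proof.
  intros Ha Hb.
  exact (filterlim_comp_2 _ _ _ Ha Hb
           (@filterlim_mult R_AbsRing la lb)).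
Qed.

Lemma right_derivative_plus (g1 g2 : R -> R) (t l1 l2 : R) :
  right_derivative g1 t l1 -> right_derivative g2 t l2 ->
  right_derivative (fun s => g1 s + g2 s) t (l1 + l2).
Proof.
  intros H1 H2. unfold right_derivative.
  apply filterlim_ext with
    (fun h => (g1 (t + h) - g1 t) / h + (g2 (t + h) - g2 t) / h).
  { intros h. unfold Rdiv. ring. }
  now apply filterlim_Rplus.
Qed.

Lemma right_derivative_opp (g : R -> R) (t l : R) :
  right_derivative g t l -> right_derivative (fun s => - g s) t (- l).
Proof.
  intros H. unfold right_derivative.
  apply filterlim_ext with (fun h => - ((g (t + h) - g t) / h)).
  { intros h. unfold Rdiv. ring. }
  exact (filterlim_comp _ _ _ _ _ _ _ _ H
           (@filterlim_opp R_AbsRing R_NormedModule l)).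
Qed.

(** The slope of [G] at [x t], completed by its limit at increment [0], is a
    continuous function of the increment; composing with it handles the
    increments of [x] that vanish. *)
Lemma right_derivative_comp (G x : R -> R) (t l k : R) :
  is_derive G (x t) l -> right_derivative x t k ->
  right_derivative (fun s => G (x s)) t (l * k).
Proof.
  intros HG Hx. apply is_derive_Reals in HG.
  set (phi := fun d => if Req_EM_T d 0 then l else (G (x t + d) - G (x t)) / d).
  assert (Hphi : filterlim phi (locally 0) (locally l)).
  { apply filterlim_locally. intros eps.
    destruct (HG eps (cond_pos eps)) as [delta Hd].
    exists delta. intros d Hb. change (Rabs (d - 0) < delta) in Hb.
    rewrite Rminus_0_r in Hb. unfold phi.
    destruct (Req_EM_T d 0) as [E|E]; [apply ball_center|].
    now apply Hd. }
  assert (Hincr : filterlim (fun h => x (t + h) - x t) (at_right 0) (locally 0)).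
  { replace 0 with (k * 0) at 2 by ring.
    apply filterlim_ext_loc with (fun h => (x (t + h) - x t) / h * h).
    - eapply filter_imp; [|exact at_right_0_pos]. intros h Hh. field. lra.
    - apply filterlim_Rmult; [exact Hx|exact filterlim_at_right_0_id]. }
  unfold right_derivative.
  apply filterlim_ext with
    (fun h => phi (x (t + h) - x t) * ((x (t + h) - x t) / h)).
  { intros h. unfold phi. destruct (Req_EM_T (x (t + h) - x t) 0) as [E|E].
    - rewrite E. replace (x (t + h)) with (x t) by lra. unfold Rdiv. ring.
    - replace (x t + (x (t + h) - x t)) with (x (t + h)) by ring.
      unfold Rdiv.
      replace ((G (x (t + h)) - G (x t)) * / (x (t + h) - x t) *
               ((x (t + h) - x t) * / h))
        with ((G (x (t + h)) - G (x t)) * / h *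
              (/ (x (t + h) - x t) * (x (t + h) - x t))) by ring.
      rewrite Rinv_l by easy. ring. }
  apply filterlim_Rmult; [|exact Hx].
  exact (filterlim_comp _ _ _ _ _ _ _ _ Hincr Hphi).
Qed.

(** For [eps > 0] the set of [t] with [g t >= g a - eps (t - a)] contains its
    supremum by continuity, and a supremum smaller than [b] could be passed,
    because the right derivative there exceeds [- eps]. *)
Lemma nondecreasing_of_right_derivative (g l : R -> R) (a b : R) :
  a <= b ->
  (forall t, a < t <= b -> continuous g t) ->
  (forall t, a <= t < b -> right_derivative g t (l t) /\ 0 <= l t) ->
  g a <= g b.
Proof.
  intros Hab Hcont Hder.
  cut (forall eps, 0 < eps -> g a <= g b + eps * (b - a)).
  { intros H. destruct (Req_dec a b) as [->|Hne]; [lra|].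
    apply le_epsilon. intros e He.
    specialize (H (e / (b - a))).
    replace (e / (b - a) * (b - a)) with e in H by (field; lra).
    apply H. apply Rdiv_lt_0_compat; lra. }
  intros eps Heps.
  set (E := fun t => a <= t <= b /\ g a <= g t + eps * (t - a)).
  destruct (completeness E) as [c [Hub Hlub]].
  { exists b. intros t [Ht _]. lra. }
  { exists a. split; [lra|]. lra. }
  assert (Hac : a <= c) by (apply Hub; split; [lra|lra]).
  assert (Hcb : c <= b) by (apply Hlub; intros t [Ht _]; lra).
  assert (HEc : E c).
  { split; [lra|]. destruct (Rle_lt_dec (g a) (g c + eps * (c - a))) as [H|H]; [easy|].
    exfalso.
    assert (Hc : a < c) by (destruct Hac as [Hc| <-]; [easy|lra]).
    set (gap := g a - (g c + eps * (c - a))).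
    assert (Hgap : 0 < gap) by (unfold gap; lra).
    destruct (proj1 (filterlim_locally _ _) (Hcont c (conj Hc Hcb))
                (mkposreal gap Hgap)) as [d Hd].
    (* every [t <= c] within [d] of [c] is outside [E], so [c - d] is a
       smaller upper bound *)
    assert (Hle : c <= c - d).
    { apply Hlub. intros t Ht. assert (Htc := Hub t Ht). destruct Ht as [Htab Hgt].
      destruct (Rle_lt_dec t (c - d)) as [H1|H1]; [easy|]. exfalso.
      assert (Hb : ball c d t) by
        (change (Rabs (t - c) < d); rewrite Rabs_left1; lra).
      specialize (Hd t Hb). change (Rabs (g t - g c) < gap) in Hd.
      apply Rabs_def2 in Hd. unfold gap in Hd.
      assert (eps * (t - a) <= eps * (c - a)) by (apply Rmult_le_compat_l; lra).
      lra. }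
    assert (Hp := cond_pos d). lra. }
  destruct HEc as [_ Hgc].
  destruct Hcb as [Hcb| ->]; [|easy]. exfalso.
  destruct (Hder c (conj Hac Hcb)) as [Hd Hl].
  assert (Hnear := proj1 (filterlim_locally _ _) Hd (mkposreal eps Heps)).
  apply at_right_0_iff in Hnear. destruct Hnear as [d [Hdpos Hnear]].
  set (h := Rmin (d / 2) (b - c)).
  assert (Hh : 0 < h < d /\ h <= b - c).
  { assert (h <= d / 2) by apply Rmin_l. assert (h <= b - c) by apply Rmin_r.
    assert (0 < h) by (apply Rmin_glb_lt; lra). lra. }
  specialize (Hnear h (proj1 Hh)).
  change (Rabs ((g (c + h) - g c) / h - l c) < eps) in Hnear.
  apply Rabs_def2 in Hnear.
  assert (Hs : g (c + h) - g c = (g (c + h) - g c) / h * h) by (field; lra).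
  assert (- eps * h <= (g (c + h) - g c) / h * h)
    by (apply Rmult_le_compat_r; lra).
  assert (c + h <= c); [|lra].
  apply Hub. split; [lra|].
  replace (eps * (c + h - a)) with (eps * (c - a) + eps * h) by ring. lra.
Qed.

(** * Continuity points of right continuous functions *)

Lemma right_continuous_small_oscillation {U : UniformSpace} (g : R -> U)
    (a b eps : R) :
  a < b -> 0 < eps -> right_continuous g a ->
  exists a' b', a < a' /\ a' < b' /\ b' < b /\
    forall s, a' <= s <= b' -> ball (g a) eps (g s).
Proof.
  intros Hab Heps Hg.
  assert (Hnear := proj1 (filterlim_locally _ _) Hg (mkposreal eps Heps)).
  apply at_right_0_iff in Hnear. destruct Hnear as [d [Hd Hnear]].
  set (m := Rmin d (b - a)).
  assert (m <= d) by apply Rmin_l. assert (m <= b - a) by apply Rmin_r.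
  assert (0 < m) by (apply Rmin_glb_lt; lra).
  exists (a + m / 3), (a + 2 * m / 3). repeat split; try lra.
  intros s Hs. replace s with (a + (s - a)) by ring. apply Hnear. lra.
Qed.

(** Strictly nested intervals on which the oscillation of [g] tends to [0]
    shrink around a point that is interior to all of them. *)
Lemma right_continuous_continuity_point {U : UniformSpace} (g : R -> U) (a b : R) :
  a < b -> (forall t, a <= t -> right_continuous g t) ->
  exists c, a < c < b /\ continuous g c.
Proof.
  intros Hab Hg.
  set (good := fun p : R * R => a <= fst p /\ fst p < snd p).
  assert (Hstep : forall (n : nat) (p : R * R), exists q : R * R, good p ->
    fst p < fst q /\ fst q < snd q /\ snd q < snd p /\
    forall s, fst q <= s <= snd q -> ball (g (fst p)) (/ INR (S n)) (g s)).
  { intros n p. destruct (excluded_middle_informative (good p)) as [Hp|Hp].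
    - destruct (right_continuous_small_oscillation g (fst p) (snd p) (/ INR (S n)))
        as (a' & b' & H); [apply Hp| |apply Hg, Hp|].
      + apply Rinv_0_lt_compat, lt_0_INR. lia.
      + now exists (a', b').
    - exists p. intros H. now elim Hp. }
  set (next := fun n p => proj1_sig (constructive_indefinite_description _ (Hstep n p))).
  assert (Hnext := fun n p =>
    proj2_sig (constructive_indefinite_description _ (Hstep n p))).
  change (forall n p, good p ->
    fst p < fst (next n p) /\ fst (next n p) < snd (next n p) /\
    snd (next n p) < snd p /\
    forall s, fst (next n p) <= s <= snd (next n p) ->
      ball (g (fst p)) (/ INR (S n)) (g s)) in Hnext.
  set (I := nat_rect (fun _ => (R * R)%type) (a, b) next).
  assert (Hgood : forall n, good (I n)).
  { induction n as [|n IH]; [split; simpl; lra|].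
    destruct (Hnext n (I n) IH) as (H1 & H2 & _). destruct IH as [H3 _].
    change (I (S n)) with (next n (I n)). split; lra. }
  assert (HI := fun n => Hnext n (I n) (Hgood n)).
  change (forall n, fst (I n) < fst (I (S n)) /\ fst (I (S n)) < snd (I (S n)) /\
    snd (I (S n)) < snd (I n) /\
    forall s, fst (I (S n)) <= s <= snd (I (S n)) ->
      ball (g (fst (I n))) (/ INR (S n)) (g s)) in HI.
  assert (HI0 : I O = (a, b)) by reflexivity.
  clearbody I. clear Hnext next Hstep.
  assert (Hmono : forall n k, fst (I n) <= fst (I (n + k)%nat) /\
                              snd (I (n + k)%nat) <= snd (I n)).
  { intros n. induction k as [|k IH].
    - rewrite Nat.add_0_r. lra.
    - rewrite Nat.add_succ_r. destruct (HI (n + k)%nat) as (H1 & _ & H3 & _). lra. }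
  assert (Hcross : forall n m, fst (I n) <= snd (I m)).
  { intros n m.
    assert (H1 := Hmono n m). assert (H2 := Hmono m n).
    rewrite (Nat.add_comm m n) in H2.
    destruct (Hgood (n + m)%nat) as [_ H3]. lra. }
  destruct (completeness (fun r => exists n, r = fst (I n))) as [c [Hub Hlub]].
  { exists (snd (I O)). intros r [n ->]. apply Hcross. }
  { now exists (fst (I O)), O. }
  assert (Hc : forall n, fst (I n) < c < snd (I n)).
  { intros n. destruct (HI n) as (H1 & _ & H3 & _).
    assert (fst (I (S n)) <= c) by (apply Hub; now exists (S n)).
    assert (c <= snd (I (S n))) by (apply Hlub; intros r [m ->]; apply Hcross).
    lra. }
  exists c. split; [specialize (Hc O); rewrite HI0 in Hc; exact Hc|].
  apply filterlim_locally. intros eps.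
  destruct (archimed_cor1 (eps / 2)) as [[|n] [Hn Hn0]];
    [assert (H := cond_pos eps); lra|lia|].
  assert (Hin : locally c (fun s => fst (I (S n)) < s < snd (I (S n)))).
  { exact (open_and _ _ (open_gt _) (open_lt _) c (Hc (S n))). }
  eapply filter_imp; [|exact Hin]. intros s Hs.
  destruct (HI n) as (_ & _ & _ & Hosc).
  specialize (Hc (S n)).
  (* both [g s] and [g c] are close to [g] at the left end of the [n]-th interval *)
  apply ball_le with (/ INR (S n) + / INR (S n)); [lra|].
  apply ball_triangle with (g (fst (I n))).
  - apply ball_sym, Hosc. lra.
  - apply Hosc. lra.
Qed.

(** * Trajectories of a semigroup *)

Lemma Hol_continuous (D U : C -> Prop) (g : C -> C) (z : C) :
  Hol D U g -> D z -> @continuous C_UniformSpace C_UniformSpace g z.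
Proof.
  intros Hg Hz. destruct (Hg z Hz) as [Hd _].
  apply ex_derive_continuous in Hd.
  (* the modulus and the product structure define the same neighbourhoods *)
  intros P HP. apply locally_C. exact (Hd P HP).
Qed.

Lemma trajectory_in_half_plane (F : R -> C -> C) (z : C) (t : R) :
  is_semigroup F -> right_half_plane z -> 0 <= t -> right_half_plane (F t z).
Proof. intros HF Hz Ht. now apply (proj1 HF t Ht). Qed.

Lemma trajectory_right_continuous (F : R -> C -> C) (z : C) (t : R) :
  is_semigroup F -> right_half_plane z -> 0 < t ->
  @right_continuous C_UniformSpace (fun s => F s z) t.
Proof.
  intros HF Hz Ht. destruct (proj2 HF) as [Hadd Hlim].
  unfold right_continuous.
  apply filterlim_ext_loc with (fun h => F h (F t z)).
  - eapply filter_imp; [|exact at_right_0_pos]. intros h Hh.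
    rewrite Hadd by (easy || lra). f_equal. ring.
  - apply Hlim, trajectory_in_half_plane; [easy|easy|lra].
Qed.

(** A continuity point [c < t] is carried to [t] by the continuous map
    [F (t - c)]. *)
Lemma trajectory_continuous (F : R -> C -> C) (z : C) (t : R) :
  is_semigroup F -> right_half_plane z -> 0 < t ->
  @continuous R_UniformSpace C_UniformSpace (fun s => F s z) t.
Proof.
  intros HF Hz Ht.
  destruct (right_continuous_continuity_point (U := C_UniformSpace)
              (fun s => F s z) (t / 2) t) as [c [Hc Hcont]].
  { lra. }
  { intros s Hs. apply trajectory_right_continuous; (easy || lra). }
  apply (continuous_ext_loc _ (fun s => F (t - c) (F (s - (t - c)) z))).
  - assert (Hloc : locally t (fun s => t - c < s)).
    { exact (open_gt (t - c) t ltac:(lra)). }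
    eapply filter_imp; [|exact Hloc]. intros s Hs. simpl in Hs.
    rewrite (proj1 (proj2 HF)) by (easy || lra). f_equal. ring.
  - apply (continuous_comp (U := R_UniformSpace) (V := C_UniformSpace)
             (W := C_UniformSpace) (fun s => F (s - (t - c)) z) (F (t - c))).
    + apply (continuous_comp (U := R_UniformSpace) (V := R_UniformSpace)
               (W := C_UniformSpace) (fun s => s - (t - c)) (fun s => F s z)).
      * apply (continuous_minus (V := R_NormedModule) (fun s => s));
          [apply continuous_id|apply continuous_const].
      * now replace (t - (t - c)) with c by ring.
    + replace (t - (t - c)) with c by ring.
      apply (Hol_continuous right_half_plane right_half_plane).
      * apply (proj1 HF). lra.
      * apply trajectory_in_half_plane; (easy || lra).
Qed.


Lemma continuous_Re (w : C) : @continuous C_UniformSpace R_UniformSpace Re w.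
Proof. destruct w as [x y]. apply (@continuous_fst R_UniformSpace R_UniformSpace). Qed.

Lemma continuous_Im (w : C) : @continuous C_UniformSpace R_UniformSpace Im w.
Proof. destruct w as [x y]. apply (@continuous_snd R_UniformSpace R_UniformSpace). Qed.

(** By continuity [F 0] fixes [z], as it fixes the points [F t z], which tend
    to [z] as [t -> 0]. *)
Lemma semigroup_at_0 (F : R -> C -> C) (z : C) :
  is_semigroup F -> right_half_plane z -> F 0 z = z.
Proof.
  intros HF Hz. destruct HF as (Hhol & Hadd & Hlim).
  apply (filterlim_locally_unique (V := C_NormedModule) (F := at_right 0)
           (fun t => F t z)); [|now apply Hlim].
  apply filterlim_ext_loc with (fun t => F 0 (F t z)).
  - eapply filter_imp; [|exact at_right_0_pos]. intros h Hh.
    rewrite Hadd by (easy || lra). f_equal. ring.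
  - apply filterlim_comp with (locally (T := C_UniformSpace) z); [now apply Hlim|].
    apply (Hol_continuous right_half_plane right_half_plane); [|easy].
    apply Hhol. lra.
Qed.

Lemma trajectory_right_derivative (F : R -> C -> C) (f : C -> C) (z : C) (t : R) :
  is_semigroup F -> is_generator F f -> right_half_plane z -> 0 <= t ->
  right_derivative (fun s => Re (F s z)) t (Re (f (F t z))) /\
  right_derivative (fun s => Im (F s z)) t (Im (f (F t z))).
Proof.
  intros HF Hgen Hz Ht.
  assert (Hlim := Hgen (F t z) (trajectory_in_half_plane F z t HF Hz Ht)).
  assert (Hquot : at_right 0 (fun h =>
    Cdiv (Cminus (F h (F t z)) (F t z)) (RtoC h) =
    ((Re (F (t + h) z) - Re (F t z)) / h, (Im (F (t + h) z) - Im (F t z)) / h))).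
  { eapply filter_imp; [|exact at_right_0_pos]. intros h Hh.
    rewrite (proj1 (proj2 HF)) by (easy || lra). rewrite (Rplus_comm h t).
    destruct (F (t + h) z) as [x' y'], (F t z) as [x y].
    unfold Cdiv, Cminus, Cinv, Cmult, Cplus, Copp, RtoC, Re, Im. simpl.
    f_equal; field; lra. }
  split; unfold right_derivative.
  - apply filterlim_ext_loc with
      (fun h => Re (Cdiv (Cminus (F h (F t z)) (F t z)) (RtoC h))).
    + eapply filter_imp; [|exact Hquot]. intros h Hh. now rewrite Hh.
    + exact (filterlim_comp _ _ _ _ _ _ _ _ Hlim (continuous_Re _)).
  - apply filterlim_ext_loc with
      (fun h => Im (Cdiv (Cminus (F h (F t z)) (F t z)) (RtoC h))).
    + eapply filter_imp; [|exact Hquot]. intros h Hh. now rewrite Hh.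
    + exact (filterlim_comp _ _ _ _ _ _ _ _ Hlim (continuous_Im _)).
Qed.

(** * The sector condition *)

Lemma sector_of_Arg (w : C) (g1 g2 : R) :
  0 < g1 < PI / 2 -> 0 < g2 < PI / 2 -> - g1 <= Arg w <= g2 ->
  0 <= Re w /\ - (tan g1 * Re w) <= Im w <= tan g2 * Re w.
Proof.
  intros H1 H2 Harg.
  assert (Hcos : 0 < cos (Arg w)) by (apply cos_gt_0; lra).
  assert (HRe : Re w = Cmod w * cos (Arg w))
    by exact (f_equal Re (Arg_polar w)).
  assert (HIm : Im w = tan (Arg w) * Re w).
  { rewrite HRe. unfold tan. rewrite (f_equal Im (Arg_polar w)). simpl.
    field. lra. }
  assert (Hpos : 0 <= Re w).
  { rewrite HRe. apply Rmult_le_pos; [apply Cmod_ge_0|lra]. }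
  assert (Hlow : - tan g1 <= tan (Arg w)).
  { rewrite <- tan_neg. destruct (proj1 Harg) as [H|H].
    - left. apply tan_increasing; lra.
    - rewrite H. lra. }
  assert (Hupp : tan (Arg w) <= tan g2).
  { destruct (proj2 Harg) as [H|H].
    - left. apply tan_increasing; lra.
    - rewrite H. lra. }
  split; [easy|]. rewrite HIm. split.
  - rewrite Ropp_mult_distr_l. now apply Rmult_le_compat_r.
  - now apply Rmult_le_compat_r.
Qed.

Lemma continuous_tan_angle (gamma : R -> R) (s : R) :
  continuous_on (fun s => 0 <= s) gamma ->
  (forall s, 0 <= s -> 0 < gamma s < PI / 2) -> 0 < s ->
  continuous (fun s => tan (gamma s)) s.
Proof.
  intros Hcont Hbd Hs.
  apply (continuous_comp gamma tan).
  - apply (continuous_continuous_on (fun s => 0 <= s)); [|easy].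
    eapply filter_imp; [|exact (open_gt 0 s Hs)]. intros r Hr. simpl in *. lra.
  - apply continuous_tan. assert (H := Hbd s (Rlt_le _ _ Hs)).
    assert (0 < cos (gamma s)) by (apply cos_gt_0; lra). lra.
Qed.

Lemma is_derive_primitive (phi : R -> R) (x0 u : R) :
  (forall s, 0 < s -> continuous phi s) -> 0 < x0 -> 0 < u ->
  is_derive (fun u => RInt phi x0 u) u (phi u).
Proof.
  intros Hphi H0 Hu.
  apply (is_derive_RInt phi _ x0); [|now apply Hphi].
  eapply filter_imp; [|exact (open_gt 0 u Hu)]. intros r Hr. simpl in Hr.
  apply (RInt_correct (V := R_CompleteNormedModule)).
  apply (ex_RInt_continuous (V := R_CompleteNormedModule)).
  intros s Hs. apply Hphi.
  assert (0 < Rmin x0 r) by now apply Rmin_glb_lt. lra.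
Qed.

(** By the chain rule [y + \int phi], with the integral up to [x], has right
    derivative [q + phi x * p >= 0].  For the lower boundary curve [y] is the
    imaginary part of a trajectory, for the upper one it is its opposite. *)
Lemma plane_path_above_primitive (phi x y p q : R -> R) (t : R) :
  (forall s, 0 < s -> continuous phi s) ->
  (forall s, 0 <= s -> 0 < x s) ->
  (forall s, 0 < s -> continuous x s /\ continuous y s) ->
  (forall s, 0 <= s ->
     right_derivative x s (p s) /\ right_derivative y s (q s)) ->
  (forall s, 0 <= s -> - (phi (x s) * p s) <= q s) ->
  0 <= t -> y 0 <= y t + RInt phi (x 0) (x t).
Proof.
  intros Hphi Hpos Hcont Hder Hslope Ht.
  set (G := (fun u => RInt phi (x 0) u) : R -> R).
  assert (HG : forall s, 0 <= s -> is_derive G (x s) (phi (x s))).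
  { intros s Hs. apply is_derive_primitive; [easy|apply Hpos; lra|now apply Hpos]. }
  assert (Hmono : y 0 + G (x 0) <= y t + G (x t)).
  { apply (nondecreasing_of_right_derivative (fun s => y s + G (x s))
             (fun s => q s + phi (x s) * p s)); [easy| |].
    - intros s Hs. destruct (Hcont s) as [Hx Hy]; [lra|].
      apply (continuous_plus (V := R_NormedModule) y (fun s => G (x s))); [easy|].
      apply (continuous_comp x G); [easy|].
      apply (ex_derive_continuous (K := R_AbsRing) (V := R_NormedModule)). exists (phi (x s)). apply HG. lra.
    - intros s [Hs _]. destruct (Hder s Hs) as [Hx Hy]. split.
      + apply right_derivative_plus; [easy|].
        now apply right_derivative_comp; [apply HG|].
      + specialize (Hslope s Hs). lra. }
  assert (HG0 : G (x 0) = 0).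
  { unfold G. rewrite RInt_point. reflexivity. }
  change (RInt phi (x 0) (x t)) with (G (x t)). lra.
Qed.

Theorem proposition3p1 :
  forall (F : R -> C -> C) (f : C -> C) (gamma1 gamma2 : R -> R),
    is_semigroup F ->
    Hol right_half_plane whole_plane f ->
    is_generator F f ->
    continuous_on (fun s : R => 0 <= s) gamma1 ->
    continuous_on (fun s : R => 0 <= s) gamma2 ->
    (forall s : R, 0 <= s -> 0 < gamma1 s < PI / 2) ->
    (forall s : R, 0 <= s -> 0 < gamma2 s < PI / 2) ->
    (forall z : C, right_half_plane z ->
       - gamma1 (Re z) <= Arg (f z) <= gamma2 (Re z)) ->
    forall z : C, right_half_plane z ->
      let B1 := fun u : R =>
        Im z - RInt (fun s : R => tan (gamma1 s)) (Re z) u in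
      let B2 := fun u : R =>
        Im z + RInt (fun s : R => tan (gamma2 s)) (Re z) u in
      forall t : R, 0 <= t ->
        Re z <= Re (F t z) /\
        B1 (Re (F t z)) <= Im (F t z) <= B2 (Re (F t z)).
Proof.
  intros F f gamma1 gamma2 HF _ Hgen Hc1 Hc2 Hb1 Hb2 Harg z Hz B1 B2 t Ht.
  set (x := fun s => Re (F s z)). set (y := fun s => Im (F s z)).
  assert (H0 := semigroup_at_0 F z HF Hz).
  assert (Hx0 : x 0 = Re z) by (unfold x; now rewrite H0).
  assert (Hy0 : y 0 = Im z) by (unfold y; now rewrite H0).
  assert (Hpos : forall s, 0 <= s -> 0 < x s)
    by (intros s Hs; now apply trajectory_in_half_plane).
  assert (Hcont : forall s, 0 < s -> continuous x s /\ continuous y s).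
  { intros s Hs. assert (Hs' := trajectory_continuous F z s HF Hz Hs).
    split.
    - exact (continuous_comp _ _ _ Hs' (continuous_Re _)).
    - exact (continuous_comp _ _ _ Hs' (continuous_Im _)). }
  assert (Hder : forall s, 0 <= s ->
    right_derivative x s (Re (f (F s z))) /\ right_derivative y s (Im (f (F s z))))
    by (intros s Hs; now apply trajectory_right_derivative).
  assert (Hsector : forall s, 0 <= s ->
    0 <= Re (f (F s z)) /\
    - (tan (gamma1 (x s)) * Re (f (F s z))) <= Im (f (F s z))
      <= tan (gamma2 (x s)) * Re (f (F s z))).
  { intros s Hs. specialize (Hpos s Hs).
    apply sector_of_Arg; [apply Hb1; lra|apply Hb2; lra|].
    now apply Harg, trajectory_in_half_plane. }
  change (Re z <= x t /\ B1 (x t) <= y t <= B2 (x t)).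
  unfold B1, B2. rewrite <- Hx0, <- Hy0.
  split; [|split].
  - apply (nondecreasing_of_right_derivative x (fun s => Re (f (F s z)))); [easy| |].
    + intros s Hs. apply Hcont. lra.
    + intros s [Hs _]. split; [apply Hder|apply Hsector]; easy.
  - assert (H := plane_path_above_primitive (fun s => tan (gamma1 s)) x y
      (fun s => Re (f (F s z))) (fun s => Im (f (F s z))) t
      (fun s => continuous_tan_angle gamma1 s Hc1 Hb1) Hpos Hcont Hder
      (fun s Hs => proj1 (proj2 (Hsector s Hs))) Ht).
    lra.
  - assert (H : - y 0 <= - y t + RInt (fun s => tan (gamma2 s)) (x 0) (x t)).
    { apply (plane_path_above_primitive (fun s => tan (gamma2 s)) x (fun s => - y s)
        (fun s => Re (f (F s z))) (fun s => - Im (f (F s z)))); try easy.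
      - intros s. now apply continuous_tan_angle.
      - intros s Hs. destruct (Hcont s Hs) as [Hx Hy]. split; [easy|].
        now apply (continuous_opp (V := R_NormedModule) y).
      - intros s Hs. destruct (Hder s Hs) as [Hx Hy]. split; [easy|].
        now apply right_derivative_opp.
      - intros s Hs. destruct (Hsector s Hs) as (_ & _ & H). lra. }
    lra.
Qed.
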